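(* (Constrained communication.) The optimal policy $f^\star$ for Problem 2, i.e. for $\inf_{f\in\mathbb F:\,J_r(f)\le b}J_e(f)$, with known channel condition $r_s$ is of Bernoulli randomized threshold type, i.e., there exist two constants $\theta^\star\in\mathbb S$ and $0\le r_{\theta^\star}\le1$ such that $$f^\star(\tau)=\begin{cases}0,&\text{if }\tau<\theta^\star,\\ 0,\ \text{with probability }1-r_{\theta^\star},&\text{if }\tau=\theta^\star,\\ 1,\ \text{with probability }r_{\theta^\star},&\text{if }\tau=\theta^\star,\\ 1,&\text{if }\tau>\theta^\star,\end{cases}$$ where $r_{\theta^\star}$ and $\theta^\star$ satisfy $$\limsup_{T\to\infty}\frac1T\,\mathbb E\Big[\sum_{k=0}^{T-1}f^\star(\tau(k))\Big]=b.$$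
   Context: System: $x(k+1)=Ax(k)+w(k)$, $y(k)=Cx(k)+v(k)$, $x(k)\in\mathbb R^n$, $y(k)\in\mathbb R^m$, with mutually independent $w(k)\sim\mathcal N(0,\Sigma_w)$, $v(k)\sim\mathcal N(0,\Sigma_v)$, $x(0)\sim\mathcal N(0,\Pi)$; $\Sigma_w,\Pi$ positive semidefinite, $\Sigma_v$ positive definite, $(A,C)$ detectable, $(A,\sqrt{\Sigma_w})$ stabilizable. A sensor runs a Kalman filter, assumed to be in steady state, and $\overline P$ is its steady-state estimation error covariance. The sensor may send its local estimate over a packet-dropping channel to a remote estimator. If $\tau$ is the time elapsed since the last successful transmission, the remote estimation error covariance is $P(0)=\overline P$ and $P(\tau)=A^\tau\overline P(A^\top)^\tau+\sum_{t=0}^{\tau-1}A^t\Sigma_w(A^\top)^t$ for $\tau\ge1$. Scheduling: the state is $\tau(k)\in\mathbb S=\mathbb N=\{0,1,2,\dots\}$, with $\tau(0)=0$; the action is $a(k)\in\{0,1\}$ ($1$ = transmit). The channel condition $r_s$ is the probability that a transmission succeeds (transmissions succeed independently): under $a=1$ the state moves from $\tau$ to $0$ with probability $r_s$ and to $\tau+1$ with probability $1-r_s$; under $a=0$ it moves to $\tau+1$ with probability $1$. An admissible policy $f=\{f_k\}_{k\ge0}$ is a sequence of mappings from the history to the transmission decision, $a(k)=f_k(\tau(0),\dots,\tau(k),a(0),\dots,a(k-1))$; $\mathbb F$ is the set of all admissible policies. A stationary policy is written $a(k)=f(\tau(k))$. The expected average estimation error and the expected average transmission rate are $$J_e(f)=\limsup_{T\to\infty}\tfrac1T\,\mathbb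 E^f\Big[\sum_{k=0}^{T-1}\operatorname{Tr}P(\tau(k))\Big|\tau(0)=0\Big],\qquad J_r(f)=\limsup_{T\to\infty}\tfrac1T\,\mathbb E^f\Big[\sum_{k=0}^{T-1}a(k)\Big|\tau(0)=0\Big].$$ The given number $b$ is the communication budget.
   Formalization: The budget is assumed to satisfy 0 < b ≤ 1 and the channel condition 0 < r_s ≤ 1: for b > 1 or b ≤ 0, or for r_s = 0 with b < 1, no threshold policy can be feasible with transmission rate exactly b. *)

(* Defs.v *)
From mathcomp Require Import all_boot all_order all_algebra.
From mathcomp Require Import complex.
From mathcomp Require Import all_classical all_reals all_analysis.

Set Implicit Arguments.
Unset Strict Implicit.
Unset Printing Implicit Defensive.

Import Order.TTheory GRing.Theory Num.Theory.
Import numFieldNormedType.Exports.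

Local Open Scope classical_set_scope.
Local Open Scope ring_scope.

Definition psd (R : realType) (n : nat) (M : 'M[R]_n) : Prop :=
  M^T = M /\ forall x : 'cV[R]_n, 0 <= (x^T *m M *m x) 0 0.

Definition posdef (R : realType) (n : nat) (M : 'M[R]_n) : Prop :=
  M^T = M /\ forall x : 'cV[R]_n, x != 0 -> 0 < (x^T *m M *m x) 0 0.

(* Discrete-time stability; the spectrum is taken over the complex numbers. *)
Definition schur_stable (R : realType) (n : nat) (M : 'M[R]_n) : Prop :=
  forall z : R[i], eigenvalue (map_mx (real_complex R) M) z -> `|z| < 1.

Definition detectable (R : realType) (n m : nat)
    (A : 'M[R]_n) (C : 'M[R]_(m, n)) : Prop :=
  exists L : 'M[R]_(n, m), schur_stable (A - L *m C).

Definition stabilizable (R : realType) (n p : nat)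
    (A : 'M[R]_n) (B : 'M[R]_(n, p)) : Prop :=
  exists K : 'M[R]_(p, n), schur_stable (A - B *m K).

Definition is_psd_sqrt (R : realType) (n : nat) (S M : 'M[R]_n) : Prop :=
  psd S /\ S *m S = M.

Definition measurement_update (R : realType) (n m : nat)
    (C : 'M[R]_(m, n)) (Sigma_v : 'M[R]_m) (X : 'M[R]_n) : 'M[R]_n :=
  X - X *m C^T *m invmx (C *m X *m C^T + Sigma_v) *m C *m X.

(* Error covariance of the prediction of x(k) from y(0), ..., y(k-1). *)
Fixpoint prior_cov (R : realType) (n m : nat) (A : 'M[R]_n)
    (C : 'M[R]_(m, n)) (Sigma_w : 'M[R]_n) (Sigma_v : 'M[R]_m)
    (Pi : 'M[R]_n) (k : nat) : 'M[R]_n :=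
  if k is j.+1 then
    A *m measurement_update C Sigma_v
           (prior_cov A C Sigma_w Sigma_v Pi j) *m A^T + Sigma_w
  else Pi.

(* Error covariance of the Kalman filter estimate of x(k) from
   y(0), ..., y(k). *)
Definition kalman_cov (R : realType) (n m : nat) (A : 'M[R]_n)
    (C : 'M[R]_(m, n)) (Sigma_w : 'M[R]_n) (Sigma_v : 'M[R]_m)
    (Pi : 'M[R]_n) (k : nat) : 'M[R]_n :=
  measurement_update C Sigma_v (prior_cov A C Sigma_w Sigma_v Pi k).

Definition steady_state_cov (R : realType) (n m : nat) (A : 'M[R]_n)
    (C : 'M[R]_(m, n)) (Sigma_w : 'M[R]_n) (Sigma_v : 'M[R]_m)
    (Pi Pbar : 'M[R]_n) : Prop :=
  kalman_cov A C Sigma_w Sigma_v Pi @ \oo --> Pbar.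

(* For tau = 0 the sum is empty and this is Pbar. *)
Definition remote_cov (R : realType) (n : nat) (A Sigma_w Pbar : 'M[R]_n)
    (tau : nat) : 'M[R]_n :=
  A ^+ tau *m Pbar *m A^T ^+ tau +
  \sum_(t < tau) A ^+ t *m Sigma_w *m A^T ^+ t.

(* [f k s u] is the probability of choosing a(k) = 1 given the history
   s = (tau(0), ..., tau(k)), u = (a(0), ..., a(k-1)); non-randomized
   policies are those with values 0 and 1. *)
Definition policy (R : realType) : Type :=
  forall k : nat, k.+1.-tuple nat -> k.-tuple bool -> R.

Definition admissible (R : realType) (f : policy R) : Prop :=
  forall (k : nat) (s : k.+1.-tuple nat) (u : k.-tuple bool),
    0 <= f k s u <= 1.

Definition action_prob (R : realType) (f : policy R) (k : nat)
    (s : k.+1.-tuple nat) (u : k.-tuple bool) (a : bool) : R :=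
  if a then f k s u else 1 - f k s u.

Definition trans_prob (R : realType) (rs : R) (tau : nat) (a : bool)
    (tau' : nat) : R :=
  if a then
    if tau' == 0%N then rs else if tau' == tau.+1 then 1 - rs else 0
  else if tau' == tau.+1 then 1 else 0.

(* Conditional expectation, given the history (s, u) at time k, of phi
   evaluated at the history at time k + j, obtained by iterating the action
   and transition kernels.  All successors of tau are at most tau + 1, so the
   inner sum covers the support of the transition kernel. *)
Fixpoint cond_expect (R : realType) (rs : R) (f : policy R)
    (phi : seq nat -> seq bool -> R) (j k : nat)
    (s : k.+1.-tuple nat) (u : k.-tuple bool) : R :=
  if j is i.+1 then
    \sum_(a : bool) action_prob f s u a *
      \sum_(tau' < (last 0%N s).+2) trans_prob rs (last 0%N s) a tau' *
        cond_expect rs f phi i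
          [tuple of rcons s (tau' : nat)] [tuple of rcons u a]
  else phi s u.

(* E^f[phi(tau(0), ..., tau(T); a(0), ..., a(T-1)) | tau(0) = 0]. *)
Definition expect (R : realType) (rs : R) (f : policy R) (T : nat)
    (phi : seq nat -> seq bool -> R) : R :=
  cond_expect rs f phi T [tuple 0%N] [tuple].

Definition J_e (R : realType) (n : nat) (A Sigma_w Pbar : 'M[R]_n)
    (rs : R) (f : policy R) : \bar R :=
  limn_esup (fun T : nat =>
    (T%:R^-1 * expect rs f T (fun s _ =>
       \sum_(k < T) \tr (remote_cov A Sigma_w Pbar (nth 0%N s k))))%:E).

Definition J_r (R : realType) (rs : R) (f : policy R) : \bar R :=
  limn_esup (fun T : nat =>
    (T%:R^-1 * expect rs f T (fun _ u =>
       \sum_(k < T) (nth false u k)%:R))%:E).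

Definition feasible (R : realType) (rs b : R) : set (policy R) :=
  [set f | admissible f /\ (J_r rs f <= b%:E)%E].

Definition constrained_optimal (R : realType) (n : nat)
    (A Sigma_w Pbar : 'M[R]_n) (rs b : R) (f : policy R) : Prop :=
  feasible rs b f /\
  J_e A Sigma_w Pbar rs f =
    ereal_inf [set J_e A Sigma_w Pbar rs g | g in feasible rs b].

Definition threshold_policy (R : realType) (theta : nat) (r : R) : policy R :=
  fun k s _ =>
    if (last 0%N s < theta)%N then 0
    else if last 0%N s == theta then r else 1.

(* Main.v *)
Require Import Defs.
From mathcomp Require Import all_boot all_order all_algebra.
From mathcomp Require Import all_classical all_reals all_analysis.
From mathcomp Require Import ring lra.

(* The stage cost [c tau = tr P(tau)] is nondecreasing, because the filter
   covariance never exceeds the one-step prediction covariance, so that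
   [Pbar <= A Pbar A^T + Sigma_w].  Choose [theta], [r] so that the randomized
   threshold rule uses exactly the budget [b].  Pricing a transmission at [l]
   so that both actions are equally good at [theta] yields a function [h]
   solving the average-cost optimality equation, for which the threshold rule
   is optimal; telescoping [h] along any policy [p] gives
   [J_e p + l * J_r p >= g], with equality for the threshold rule.
   As [c], and even the optimal cost, may be unbounded, the argument is applied
   to the costs [c (min tau N)]: their potential is bounded, they minorize [c],
   and they agree with [c] up to time [N], since [tau(k) <= k]. *)

Set Implicit Arguments.
Unset Strict Implicit.
Unset Printing Implicit Defensive.

Import Order.TTheory GRing.Theory Num.Theory.
Import numFieldNormedType.Exports.
Local Open Scope classical_set_scope.
Local Open Scope ring_scope.

(** * Monotonicity of the remote error covariance *)

Lemma posdef_unit (R : realType) (n : nat) (S : 'M[R]_n) :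
  posdef S -> S \in unitmx.
Proof.
move=> [_ hS]; rewrite -row_free_unit -kermx_eq0.
apply/negPn/negP => /rowV0Pn [v] /sub_kermxP vS v0.
have := hS v^T; rewrite trmxK vS mul0mx mxE ltxx => H.
apply: notF; apply: H; apply: contraNneq v0 => /(congr1 trmx).
by rewrite trmxK trmx0 => ->.
Qed.

Lemma posdef_psd (R : realType) (n : nat) (S : 'M[R]_n) : posdef S -> psd S.
Proof.
move=> [sS hS]; split=> // x; have [->|x0] := eqVneq x 0.
  by rewrite mulmx0 mxE.
exact/ltW/hS.
Qed.

Lemma psdD (R : realType) (n : nat) (X Y : 'M[R]_n) :
  psd X -> psd Y -> psd (X + Y).
Proof.
move=> [sX hX] [sY hY]; split; first by rewrite linearD /= sX sY.
by move=> x; rewrite mulmxDr mulmxDl mxE addr_ge0.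
Qed.

Lemma psd_congr (R : realType) (m n : nat) (C : 'M[R]_(m, n)) (X : 'M[R]_n) :
  psd X -> psd (C *m X *m C^T).
Proof.
move=> [sX hX]; split; first by rewrite !trmx_mul trmxK sX mulmxA.
move=> x; have := hX (C^T *m x).
by rewrite trmx_mul trmxK !mulmxA.
Qed.

Lemma innovation_posdef (R : realType) (n m : nat) (C : 'M[R]_(m, n))
    (V : 'M[R]_m) (X : 'M[R]_n) :
  posdef V -> psd X -> posdef (C *m X *m C^T + V).
Proof.
move=> [sV hV] hX; have [sY hY] := psd_congr C hX; split.
  by rewrite linearD /= sY sV.
by move=> x x0; rewrite mulmxDr mulmxDl mxE ltr_wpDl // hV.
Qed.

Section Update.
Context (R : realType) (n m : nat) (C : 'M[R]_(m, n)) (V : 'M[R]_m)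
  (X : 'M[R]_n) (hV : posdef V) (hX : psd X).

Let S := C *m X *m C^T + V.
Let y (x : 'cV[R]_n) := invmx S *m (C *m X *m x).

(** Symmetry of [X] and [S] turns the subtracted term [X C^T S^-1 C X] into
    [(S^-1 C X)^T S (S^-1 C X)], whose sign is that of [S]. *)
Lemma gain_quad (x : 'cV[R]_n) :
  (x^T *m (X - measurement_update C V X) *m x) 0 0
  = ((y x)^T *m S *m y x) 0 0.
Proof.
have [sS _] := innovation_posdef C hV hX; rewrite -/S in sS.
have uS : S \in unitmx by exact/posdef_unit/innovation_posdef.
congr (_ _ 0 0); rewrite /measurement_update -/S opprB addrC subrK /y.
rewrite !trmx_mul hX.1 trmx_inv sS !mulmxA mulmxKV //.
Qed.

Lemma update_le (x : 'cV[R]_n) :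
  0 <= (x^T *m (X - measurement_update C V X) *m x) 0 0.
Proof.
by rewrite gain_quad; case: (posdef_psd (innovation_posdef C hV hX)) => _; apply.
Qed.

Lemma update_psd : psd (measurement_update C V X).
Proof.
have [sS _] := innovation_posdef C hV hX; rewrite -/S in sS.
have uS : S \in unitmx by exact/posdef_unit/innovation_posdef.
have [sX qX] := hX; split.
  by rewrite /measurement_update -/S linearB /= !trmx_mul trmxK trmx_inv sS sX !mulmxA.
move=> x.
(* Completing the square: with [z = S^-1 C X x], the updated quadratic form at
   [x] is [(x - C^T z)^T X (x - C^T z) + z^T V z]. *)
have q1 := qX (x - C^T *m y x).
have [_ /(_ (y x)) q2] := posdef_psd hV.
have g := gain_quad x.
have Sy : S *m y x = C *m X *m x by rewrite /y mulKVmx.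
move: (y x) q1 q2 g Sy => z q1 q2 g Sy.
have cross : z^T *m C *m X *m x = z^T *m S *m z.
  by rewrite -[in RHS]mulmxA Sy !mulmxA.
have cross' : x^T *m X *m C^T *m z = z^T *m S *m z.
  have -> : x^T *m X *m C^T = z^T *m S; last by [].
  by rewrite -[S in RHS]sS -trmx_mul Sy !trmx_mul sX mulmxA.
have expand : (x - C^T *m z)^T *m X *m (x - C^T *m z) =
    x^T *m X *m x - z^T *m S *m z - z^T *m V *m z.
  rewrite [(_ - _)^T]linearB /= trmx_mul trmxK mulmxBl mulmxBl !mulmxBr !mulmxA.
  rewrite cross cross'.
  have -> : z^T *m S *m z =
      z^T *m C *m X *m C^T *m z + z^T *m V *m z.
    by rewrite /S mulmxDr mulmxDl !mulmxA.
  by congr (_ - _); rewrite addrAC subrr add0r.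
have entryB (k : nat) (P Q : 'M[R]_k) i j : (P - Q) i j = P i j - Q i j.
  by rewrite !mxE.
by move: q1 q2 g; rewrite expand mulmxBr mulmxBl !entryB; lra.
Qed.
End Update.

Lemma prior_psd (R : realType) (n m : nat) (A : 'M[R]_n) (C : 'M[R]_(m, n))
    (W : 'M[R]_n) (V : 'M[R]_m) (Pi : 'M[R]_n) (k : nat) :
  psd W -> posdef V -> psd Pi -> psd (prior_cov A C W V Pi k).
Proof.
move=> hW hV hPi; elim: k => [//|k IH] /=.
by apply: psdD => //; apply/psd_congr/update_psd.
Qed.

Lemma cvg_quad (R : realType) (n : nat) (M : nat -> 'M[R]_n.+1)
    (L : 'M[R]_n.+1) (x : 'cV[R]_n.+1) :
  M @ \oo --> L ->
  (fun k => (x^T *m M k *m x) 0 0) @ \oo --> (x^T *m L *m x) 0 0.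
Proof.
move=> ML.
have quadE (N : 'M[R]_n.+1) :
    (x^T *m N *m x) 0 0 = \sum_j (\sum_i x i 0 * N i j) * x j 0.
  rewrite mxE; apply: eq_bigr => j _; rewrite mxE; congr (_ * _).
  by apply: eq_bigr => i _; rewrite mxE.
rewrite quadE; under eq_fun do rewrite quadE.
apply: cvg_big => [|j _]; first exact: add_continuous.
apply: cvgM; last exact: cvg_cst.
apply: cvg_big => [|i _]; first exact: add_continuous.
apply: cvgM; first exact: cvg_cst.
have cN : {for L, continuous (fun N : 'M[R]_n.+1 => N i j)}.
  exact: coord_continuous.
exact: (continuous_cvg _ cN ML).
Qed.

(** Along the filter, [A *m K k *m A^T + W] is by definition the prior covariance at [k.+1], and
    [K k.+1] is its measurement update; so [update_le] gives the sign for every [k], and it survives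
    the limit. *)
Lemma steady_state_le (R : realType) (n m : nat) (A : 'M[R]_n.+1)
    (C : 'M[R]_(m, n.+1)) (W : 'M[R]_n.+1) (V : 'M[R]_m)
    (Pi Pbar : 'M[R]_n.+1) (x : 'cV[R]_n.+1) :
  psd W -> posdef V -> psd Pi -> steady_state_cov A C W V Pi Pbar ->
  0 <= (x^T *m (A *m Pbar *m A^T + W - Pbar) *m x) 0 0.
Proof.
move=> hW hV hPi hP.
set K := kalman_cov A C W V Pi.
have quadE (N N' : 'M[R]_n.+1) : (x^T *m (A *m N *m A^T + W - N') *m x) 0 0 =
    ((A^T *m x)^T *m N *m (A^T *m x)) 0 0 + (x^T *m W *m x) 0 0 -
    (x^T *m N' *m x) 0 0.
  rewrite mulmxBr mulmxBl mulmxDr mulmxDl [LHS]mxE [X in X + _]mxE.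
  rewrite [X in _ + X = _]mxE; congr (_ 0 0 + _ - _).
  by rewrite trmx_mul trmxK !mulmxA.
have cv : (fun k => (x^T *m (A *m K k *m A^T + W - K k.+1) *m x) 0 0) @ \oo
    --> (x^T *m (A *m Pbar *m A^T + W - Pbar) *m x) 0 0.
  rewrite quadE; under eq_fun do rewrite quadE.
  apply: cvgB; last by apply: cvg_quad; rewrite (@cvg_shiftS _ K).
  by apply: cvgD; [exact: cvg_quad | exact: cvg_cst].
rewrite -(cvg_lim _ cv) //; apply: limr_ge; first by apply/cvg_ex; eexists; exact: cv.
apply: nearW => k.
exact: (update_le C hV (prior_psd A C k.+1 hW hV hPi)).
Qed.

(** The increment at [t] is [A^t D (A^T)^t] with [D = A Pbar A^T + W - Pbar]; its trace sums the
    quadratic form of [D] over the rows of [A^t]. *)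
Lemma remote_cov_trace_nondecreasing (R : realType) (n m : nat) (A : 'M[R]_n.+1)
    (C : 'M[R]_(m, n.+1)) (W : 'M[R]_n.+1) (V : 'M[R]_m)
    (Pi Pbar : 'M[R]_n.+1) :
  psd W -> posdef V -> psd Pi -> steady_state_cov A C W V Pi Pbar ->
  {homo (fun tau => \tr (remote_cov A W Pbar tau)) : s t / (s <= t)%N >-> s <= t}.
Proof.
move=> hW hV hPi hP.
apply: homo_leq => [x //|y x z|t]; first exact: le_trans.
rewrite -subr_ge0 -linearB /=.
have -> : remote_cov A W Pbar t.+1 - remote_cov A W Pbar t =
    A ^+ t *m (A *m Pbar *m A^T + W - Pbar) *m A^T ^+ t.
  have eA : A ^+ t.+1 = A ^+ t *m A by rewrite exprSr.
  have eT : A^T ^+ t.+1 = A^T *m A^T ^+ t by rewrite exprS.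
  rewrite /remote_cov big_ord_recr /= eA eT.
  rewrite mulmxBr mulmxBl mulmxDr mulmxDl !mulmxA opprD addrACA.
  by rewrite [X in _ + (X + _)]addrC addrAC addrK addrAC.
have -> : A^T ^+ t = (A ^+ t)^T.
  elim: t => [|t IH]; first by rewrite !expr0 trmx1.
  by rewrite exprSr IH exprS trmx_mul.
rewrite /mxtrace sumr_ge0 // => i _.
have := steady_state_le (row i (A ^+ t))^T hW hV hPi hP.
set D := A *m Pbar *m A^T + W - Pbar; set M := A ^+ t.
rewrite trmxK -row_mul.
suff -> : (row i (M *m D) *m (row i M)^T) 0 0 = (M *m D *m M^T) i i by [].
by rewrite mxE [RHS]mxE; apply: eq_bigr => j _; rewrite !mxE.
Qed.

(** * Upper limits *)

Lemma near_mulVn_le (R : realType) (K e : R) : 0 < e ->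
  \forall T \near \oo%classic, (0 < T)%N /\ T%:R^-1 * K <= e.
Proof.
move=> e0; exists (Num.trunc (`|K| / e)).+1 => //= T /= NT.
have T0 : (0 < T)%N by exact: leq_trans NT.
split=> //; rewrite mulrC ler_pdivrMr ?ltr0n //.
apply: le_trans (ler_norm K) _; rewrite mulrC -ler_pdivrMr //.
have /truncn_itv/andP[_ /ltW Kt] : 0 <= `|K| / e by rewrite divr_ge0 // ltW.
by apply: le_trans Kt _; rewrite ler_nat.
Qed.

(** The upper limit is an infimum, over the sets of the filter, of suprema; the set where
    [u T <= x + e] is one of these sets. *)
Lemma limn_esup_le_near (R : realType) (u : nat -> R) (x : R) :
  (forall e, 0 < e -> \forall T \near \oo%classic, u T <= x + e) ->
  (limn_esup (fun T => (u T)%:E) <= x%:E)%E.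
Proof.
move=> ux; apply/lee_addgt0Pr => e e0; rewrite -EFinD.
apply: (@le_trans _ _ (ereal_sup [set (u T)%:E | T in [set T | u T <= x + e]])).
  apply: ereal_inf_lbound; exists [set T | u T <= x + e]%classic => //.
  exact: ux.
by apply: ge_ereal_sup => _ [T /= uT <-]; rewrite lee_fin.
Qed.

Lemma near_limn_esup_le (R : realType) (u : nat -> R) (x e : R) : 0 < e ->
  (limn_esup (fun T => (u T)%:E) <= x%:E)%E ->
  \forall T \near \oo%classic, u T <= x + e.
Proof.
move=> e0 ux.
have : (limn_esup (fun T => (u T)%:E) < (x + e)%:E)%E.
  by apply: le_lt_trans ux _; rewrite lte_fin ltrDl.
move=> /ereal_inf_lt[_ [V Voo <-] Vx]; apply: filterS Voo => T VT.
rewrite -lee_fin ltW //; apply: le_lt_trans Vx.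
by apply: ereal_sup_ubound; exists T.
Qed.

Lemma le_limn_esup_near (R : realType) (u : nat -> R) (x : R) :
  (forall e, 0 < e -> \forall T \near \oo%classic, x - e <= u T) ->
  (x%:E <= limn_esup (fun T => (u T)%:E))%E.
Proof.
move=> ux; apply: le_ereal_inf_tmp => _ [V Voo <-].
apply/lee_subgt0Pr => e e0; rewrite -EFinB.
have [T [VT uT]] : exists T, V T /\ x - e <= u T.
  by apply: (@filter_ex _ \oo%classic); apply: filterI Voo (ux e e0).
apply: le_trans (_ : (u T)%:E <= _)%E; first by rewrite lee_fin.
by apply: ereal_sup_ubound; exists T.
Qed.

(** * Expectations along a policy *)

Lemma cond_expectS (R : realType) (rs : R) (f : policy R)
    (phi : seq nat -> seq bool -> R) (j k : nat)
    (s : k.+1.-tuple nat) (u : k.-tuple bool) :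
  let t := last 0%N s in
  cond_expect rs f phi j.+1 s u =
    f k s u *
      (rs * cond_expect rs f phi j [tuple of rcons s 0%N] [tuple of rcons u true] +
       (1 - rs) *
         cond_expect rs f phi j [tuple of rcons s t.+1] [tuple of rcons u true]) +
    (1 - f k s u) *
      cond_expect rs f phi j [tuple of rcons s t.+1] [tuple of rcons u false].
Proof.
move=> t; rewrite /= big_bool /= /action_prob -/t.
(* Of the successors [0, ..., t.+1] only the two ends can carry mass; the inner terms vanish. *)
by congr (_ * _ + _ * _); rewrite big_ord_recl big_ord_recr /= big1 => [|i _];
  rewrite /trans_prob /= /bump /= ?add1n ?eqxx ?mul0r ?mul1r ?add0r //;
  rewrite eqSS (ltn_eqF (ltn_ord i)) mul0r.
Qed.

(* The time spent since the last reception never exceeds the clock, so only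
   histories with [nth 0 s i <= i] have positive probability. *)
Lemma cond_expect_le (R : realType) (rs : R) (f : policy R)
    (phi psi : seq nat -> seq bool -> R) (T j k : nat)
    (s : k.+1.-tuple nat) (u : k.-tuple bool) :
  0 <= rs <= 1 -> admissible f ->
  (forall s u, size s = T.+1 -> size u = T ->
    (forall i, (nth 0 s i <= i)%N) -> phi s u <= psi s u) ->
  (k + j)%N = T -> (forall i, (nth 0 s i <= i)%N) ->
  cond_expect rs f phi j s u <= cond_expect rs f psi j s u.
Proof.
move=> /andP[rs0 rs1] fadm le.
elim: j k s u => [|j IH] k s u kj sP.
  by rewrite /=; apply: le; rewrite ?size_tuple -?kj ?addn0.
have inv x i : (x <= (last 0 s).+1)%N -> (nth 0 (rcons s x) i <= i)%N.
  move=> xs; rewrite nth_rcons size_tuple; case: ltngtP => // ->.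
  apply: (leq_trans xs); rewrite ltnS.
  by rewrite -nth_last size_tuple; exact: sP.
rewrite !cond_expectS; have /andP[f0 f1] := fadm k s u.
have f1' : 0 <= 1 - f k s u by rewrite subr_ge0.
have rs1' : 0 <= 1 - rs by rewrite subr_ge0.
rewrite lerD // ler_wpM2l //; last by apply: IH => [|i]; [rewrite addSnnS|exact: inv].
by rewrite lerD // ler_wpM2l //; apply: IH => [|i]; rewrite ?addSnnS //; exact: inv.
Qed.

Lemma cond_expect_linear (R : realType) (rs : R) (f : policy R)
    (phi psi : seq nat -> seq bool -> R) (x : R) (j k : nat)
    (s : k.+1.-tuple nat) (u : k.-tuple bool) :
  cond_expect rs f (fun s u => phi s u + x * psi s u) j s u =
  cond_expect rs f phi j s u + x * cond_expect rs f psi j s u.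
Proof.
elim: j k s u => [//|j IH] k s u; rewrite !cond_expectS !IH; ring.
Qed.

Lemma cond_expect_cst (R : realType) (rs : R) (f : policy R)
    (x : R) (j k : nat) (s : k.+1.-tuple nat) (u : k.-tuple bool) :
  cond_expect rs f (fun _ _ => x) j s u = x.
Proof.
elim: j k s u => [//|j IH] k s u; rewrite !cond_expectS !IH; ring.
Qed.

Lemma cond_expect_submartingale (R : realType) (rs : R) (f : policy R)
    (phi : seq nat -> seq bool -> R) (j k : nat)
    (s : k.+1.-tuple nat) (u : k.-tuple bool) :
  0 <= rs <= 1 -> admissible f ->
  (forall k (s : k.+1.-tuple nat) (u : k.-tuple bool),
     phi s u <= cond_expect rs f phi 1 s u) ->
  phi s u <= cond_expect rs f phi j s u.
Proof.
move=> /andP[rs0 rs1] fadm sub.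
elim: j k s u => [//|j IH] k s u.
apply: le_trans (sub k s u) _.
rewrite !cond_expectS; have /andP[f0 f1] := fadm k s u.
have f1' : 0 <= 1 - f k s u by rewrite subr_ge0.
have rs1' : 0 <= 1 - rs by rewrite subr_ge0.
rewrite lerD // ler_wpM2l //; last exact: IH.
by rewrite lerD // ler_wpM2l //; exact: IH.
Qed.

(* A submartingale as soon as [h] satisfies the optimality inequalities for the
   stage cost [c t + l a] and the average cost [g]. *)
Definition potential (R : realType) (c h : nat -> R) (l g : R)
    (s : seq nat) (u : seq bool) : R :=
  \sum_(i < size u) (c (nth 0%N s i) + l * (nth false u i)%:R - g) + h (last 0%N s).

Lemma potential_rcons (R : realType) (c h : nat -> R) (l g : R) k
    (s : k.+1.-tuple nat) (u : k.-tuple bool) (x : nat) (a : bool) :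
  potential c h l g (rcons s x) (rcons u a) =
  potential c h l g s u + (c (last 0%N s) + l * a%:R - g) + h x - h (last 0%N s).
Proof.
rewrite /potential size_rcons last_rcons big_ord_recr /=.
have -> : nth 0%N (rcons s x) (size u) = last 0%N s.
  by rewrite size_tuple nth_rcons size_tuple ltnSn -nth_last size_tuple.
rewrite nth_rcons ltnn eqxx (eq_bigr (fun i : 'I_(size u) =>
  c (nth 0%N s i) + l * (nth false u i)%:R - g)); first by ring.
move=> [i /= iu] _; rewrite !nth_rcons iu size_tuple ltnS ltnW //.
by rewrite -(size_tuple u).
Qed.

(** Each bracket is the defect of one action in the average-cost optimality equation with relative
    value [h]: first transmitting, then waiting. *)
Lemma potential_drift (R : realType) (rs : R) (f : policy R)
    (c h : nat -> R) (l g : R) k (s : k.+1.-tuple nat) (u : k.-tuple bool) :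
  let t := last 0%N s in
  cond_expect rs f (potential c h l g) 1 s u = potential c h l g s u
   + f k s u * (c t + l - g + rs * h 0%N + (1 - rs) * h t.+1 - h t)
   + (1 - f k s u) * (c t - g + h t.+1 - h t).
Proof. by move=> t; rewrite cond_expectS /= !potential_rcons -/t /=; ring. Qed.

(** The stage cost is left free so that it can be the trace, a truncation, a negative or zero. *)
Definition total_cost (R : realType) (rs : R) (f : policy R)
    (c : nat -> R) (T : nat) : R :=
  expect rs f T (fun s _ => \sum_(k < T) c (nth 0%N s k)).

Definition total_rate (R : realType) (rs : R) (f : policy R) (T : nat) : R :=
  expect rs f T (fun _ u => \sum_(k < T) (nth false u k)%:R).

Lemma total_costN (R : realType) (rs : R) (f : policy R) (c : nat -> R) (T : nat) :
  total_cost rs f (fun t => - c t) T = - total_cost rs f c T.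
Proof.
rewrite -[RHS]add0r -[X in X + _](cond_expect_cst rs f 0 T [tuple 0%N] [tuple]).
rewrite -mulN1r -cond_expect_linear; congr expect.
by apply/funext => s; apply/funext => u; rewrite add0r mulN1r sumrN.
Qed.

(** The state never exceeds the clock, so comparing the costs up to [T] suffices. This makes
    truncation at [N] invisible up to horizon [N]. *)
Lemma total_cost_le (R : realType) (rs : R) (f : policy R) (c c' : nat -> R) (T : nat) :
  0 <= rs <= 1 -> admissible f ->
  (forall t, (t <= T)%N -> c t <= c' t) ->
  total_cost rs f c T <= total_cost rs f c' T.
Proof.
move=> rs01 fadm cc'; apply: (@cond_expect_le _ _ _ _ _ T) => // [s u _ _ sP|].
  by apply: ler_sum => i _; apply/cc'/(leq_trans (sP i))/ltnW.
by case=> [|[|i]].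
Qed.

(** The potential starts at [h 0 = 0], so its mean at time [T] is nonnegative, while its final term
    is at most [H]. The drift hypothesis omits [rs * h 0], which is zero. *)
Lemma submartingale_bound (R : realType) (rs : R) (f : policy R)
    (c h : nat -> R) (l g H : R) (T : nat) :
  0 <= rs <= 1 -> admissible f -> h 0%N = 0 -> (forall t, h t <= H) ->
  (forall k (s : k.+1.-tuple nat) (u : k.-tuple bool) t, t = last 0%N s ->
     0 <= f k s u * (c t + l - g + (1 - rs) * h t.+1 - h t)
          + (1 - f k s u) * (c t - g + h t.+1 - h t)) ->
  g * T%:R - H <= total_cost rs f c T + l * total_rate rs f T.
Proof.
move=> rs01 fadm h0 hH drift.
have sub : 0 <= expect rs f T (potential c h l g).
  have -> : 0 = potential c h l g [tuple 0%N] [tuple].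
    by rewrite /potential big_ord0 h0 addr0.
  apply: cond_expect_submartingale => // k s u; rewrite potential_drift.
  by have := drift k s u _ erefl; rewrite h0; lra.
have : expect rs f T (potential c h l g) <=
    total_cost rs f c T + l * total_rate rs f T + 1 * (H - g * T%:R).
  rewrite -(cond_expect_cst rs f (H - g * T%:R) T [tuple 0%N] [tuple]).
  rewrite -!cond_expect_linear.
  apply: (@cond_expect_le _ _ _ _ _ T) => // [s u _ uT _|].
    rewrite /potential uT !big_split /= -mulr_sumr sumr_const card_ord.
    by rewrite mulNrn -[g *+ T]mulr_natr; have := hH (last 0%N s); lra.
  by case=> [|[|i]].
lra.
Qed.

(** Changing the signs of [c], [h], [l] and [g] reduces this to the submartingale bound with
    [H = 0]. *)
Lemma supermartingale_bound (R : realType) (rs : R) (f : policy R)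
    (c h : nat -> R) (l g : R) (T : nat) :
  0 <= rs <= 1 -> admissible f -> h 0%N = 0 -> (forall t, 0 <= h t) ->
  (forall k (s : k.+1.-tuple nat) (u : k.-tuple bool) t, t = last 0%N s ->
     f k s u * (c t + l - g + (1 - rs) * h t.+1 - h t)
          + (1 - f k s u) * (c t - g + h t.+1 - h t) <= 0) ->
  total_cost rs f c T + l * total_rate rs f T <= g * T%:R.
Proof.
move=> rs01 fadm h0 hge drift.
have h0' : - h 0%N = 0 by rewrite h0 oppr0.
have := @submartingale_bound R rs f (fun t => - c t) (fun t => - h t) (- l) (- g) 0 T
  rs01 fadm h0'.
rewrite total_costN => H.
suff : - g * T%:R - 0 <= - total_cost rs f c T + - l * total_rate rs f T by lra.
apply: H => // [t|k s u t tE]; first by rewrite oppr_le0.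
have := drift k s u t tE; lra.
Qed.

(** * Threshold rules *)

(* Mean of [c (t + G)], with [G] the number of failures before the first
   success (geometric), cut off after [K] trials. *)
Fixpoint geom_mean (R : realType) (rs : R) (c : nat -> R) (K t : nat) : R :=
  if K is J.+1 then rs * c t + (1 - rs) * geom_mean rs c J t.+1 else c t.

Section GeomMean.
Context (R : realType) (rs : R) (c : nat -> R) (N : nat).
Hypotheses (rs01 : 0 < rs <= 1)
  (c_ndecr : {homo c : s t / (s <= t)%N >-> s <= t})
  (c_cst : forall t, (N <= t)%N -> c t = c N).

Let rs_ge0 : 0 <= rs. Proof. by case/andP: rs01 => /ltW. Qed.
Let q_ge0 : 0 <= 1 - rs. Proof. by rewrite subr_ge0; case/andP: rs01. Qed.

(** Once the cutoff reaches the range where [c] is constant, one more trial changes nothing, so the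
    recursion holds with the same [K] on both sides. *)
Lemma geom_mean_fix K t : (N <= t + K)%N ->
  geom_mean rs c K t = rs * c t + (1 - rs) * geom_mean rs c K t.+1.
Proof.
elim: K t => [|K IH] t Nt /=.
  by rewrite addn0 in Nt; rewrite (c_cst Nt) c_cst ?leqW //; ring.
by rewrite -(IH t.+1) // addSnnS.
Qed.

Lemma geom_mean_ge K t : c t <= geom_mean rs c K t.
Proof.
elim: K t => [//|K IH] t /=.
have := ler_wpM2l q_ge0 (le_trans (c_ndecr (leqnSn t)) (IH t.+1)); lra.
Qed.

Lemma geom_mean_le K t : geom_mean rs c K t <= c N.
Proof.
have cN s : c s <= c N.
  by have [/c_ndecr //|/ltnW/c_cst ->] := leqP s N.
elim: K t => [|K IH] t //=.
have := ler_wpM2l q_ge0 (IH t.+1); have := ler_wpM2l rs_ge0 (cN t); lra.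
Qed.

Lemma geom_mean_ndecr K :
  {homo geom_mean rs c K : s t / (s <= t)%N >-> s <= t}.
Proof.
elim: K => [|K IH] s t st /=; first exact: c_ndecr.
by rewrite lerD // ler_wpM2l //; [exact: c_ndecr | exact: IH].
Qed.

(* The potential of the threshold-[theta] rule when the price [l] of a
   transmission makes both actions equally good at [theta]. *)
Lemma threshold_potential (theta : nat) :
  exists (g l : R) (h : nat -> R) (H : R),
    [/\ l = rs * \sum_(i < theta.+1) (g - c i), c theta <= g,
        rs = 1 -> g = c theta.+1, h 0%N = 0 & forall t, 0 <= h t <= H] /\
    [/\ forall t, 0 <= c t - g + h t.+1 - h t,
        forall t, 0 <= c t + l - g + (1 - rs) * h t.+1 - h t,
        forall t, (t <= theta)%N -> c t - g + h t.+1 - h t = 0 &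
        forall t, (theta <= t)%N ->
          c t + l - g + (1 - rs) * h t.+1 - h t = 0].
Proof.
have /andP[rs0 rs1] := rs01.
(* [W t] is the mean cost at the successful attempt when transmitting persistently from [t]. The
   value of [g] is forced by matching the two pieces of [h] at [theta.+1]. *)
pose W := geom_mean rs c N; pose g := W theta.+1.
have WS t : W t = rs * c t + (1 - rs) * W t.+1.
  by apply: geom_mean_fix; rewrite leq_addl.
have Wmon : {homo W : s t / (s <= t)%N >-> s <= t} := @geom_mean_ndecr N.
have cg t : (t <= theta)%N -> c t <= g.
  move=> tt; apply: le_trans (geom_mean_ge N theta.+1).
  exact/c_ndecr/leqW.
(* Waiting balances the equation up to [theta], which yields the partial sums; transmitting balances
   it beyond, which adds [(W t - g) / rs]. *)
pose h t := \sum_(0 <= i < minn t theta.+1) (g - c i) + (W (maxn t theta.+1) - g) / rs.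
have hlow t : (t <= theta.+1)%N -> h t = \sum_(0 <= i < t) (g - c i).
  by move=> tt; rewrite /h (minn_idPl tt) (maxn_idPr tt) subrr mul0r addr0.
have hhigh t : (theta < t)%N -> h t = h theta.+1 + (W t - g) / rs.
  by move=> tt; rewrite (hlow theta.+1) // /h (minn_idPr tt) (maxn_idPl tt).
have hS t : (t <= theta)%N -> h t.+1 = h t + (g - c t).
  by move=> tt; rewrite !hlow ?big_nat_recr // leqW.
have hS' t : (theta < t)%N -> h t.+1 = h t + (W t.+1 - W t) / rs.
  by move=> tt; rewrite (hhigh t.+1) ?leqW // (hhigh t) //; ring.
have hmon : {homo h : s t / (s <= t)%N >-> s <= t}.
  apply: homo_leq => [//|y x z|t]; first exact: le_trans.
  have [tt|tt] := leqP t theta.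
    by rewrite hS // lerDl subr_ge0 cg.
  by rewrite hS' // lerDl divr_ge0 // subr_ge0 Wmon.
have h0 : h 0%N = 0 by rewrite hlow // big_nil.
(* As [h 0 = 0], transmitting at [t] costs [l] and saves [rs * h t.+1] compared with waiting; this
   price equates the two at [theta]. *)
pose l := rs * h theta.+1.
have A0low t : (t <= theta)%N -> c t - g + h t.+1 - h t = 0.
  by move=> tt; rewrite hS //; ring.
have A0high t : (theta < t)%N -> c t - g + h t.+1 - h t = W t.+1 - g.
  move=> tt; rewrite hS' //; have := WS t; set w := W t => ->.
  by field; exact: lt0r_neq0.
have A1E t : c t + l - g + (1 - rs) * h t.+1 - h t =
    c t - g + h t.+1 - h t + rs * (h theta.+1 - h t.+1).
  by rewrite /l; ring.
have A1low t : (t <= theta)%N ->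
  c t + l - g + (1 - rs) * h t.+1 - h t = rs * (h theta.+1 - h t.+1).
  by move=> tt; rewrite A1E A0low ?add0r.
have A1high t : (theta < t)%N -> c t + l - g + (1 - rs) * h t.+1 - h t = 0.
  move=> tt; rewrite A1E A0high // (hhigh t.+1) ?leqW //.
  by field; exact: lt0r_neq0.
(* The upper bound on [h] comes from [W t <= c N]. *)
exists g, l, h, (h theta.+1 + (c N - g) / rs); split; split => //.
- by rewrite /l hlow // big_mkord.
- exact: cg.
- by move=> rsE; rewrite /g WS rsE; ring.
- move=> t; rewrite -{1}h0 hmon //=.
  have [tt|tt] := leqP t theta.+1.
    apply: le_trans (hmon _ _ tt) _.
    by rewrite lerDl divr_ge0 // subr_ge0 geom_mean_le.
  by rewrite hhigh ?(ltnW tt) // lerD2l ler_pM2r ?invr_gt0 // lerD2r geom_mean_le.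
- move=> t; have [tt|tt] := leqP t theta; first by rewrite A0low.
  by rewrite A0high // subr_ge0 Wmon // leqW.
- move=> t; have [tt|tt] := leqP t theta; last by rewrite A1high.
  by rewrite A1low // mulr_ge0 // subr_ge0 hmon.
- move=> t; rewrite leq_eqVlt => /predU1P[<-|]; last exact: A1high.
  by rewrite A1low // subrr mulr0.
Qed.
End GeomMean.

(** * Transmission rate and optimality of the calibrated threshold rule *)

Section Threshold.
Context (R : realType) (rs b r : R) (theta : nat) (c : nat -> R).
Hypotheses (rs01 : 0 < rs <= 1) (b0 : 0 < b) (r01 : 0 <= r <= 1)
  (c_ndecr : {homo c : s t / (s <= t)%N >-> s <= t})
  (budget : b * (1 + rs * (theta%:R + 1 - r)) = 1).

Let f := threshold_policy theta r.

Let rs01' : 0 <= rs <= 1. Proof. by case/andP: rs01 => /ltW -> ->. Qed.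

Lemma threshold_admissible : admissible f.
Proof.
by move=> k s u; rewrite /f /threshold_policy; case: ifP => _; [|case: ifP => _];
  rewrite ?lexx ?ler01.
Qed.

(** A cycle between receptions has mean length [theta + 1 - r + 1 / rs] and contains [1 / rs]
    transmissions on average; [budget] says that the ratio is [b]. *)
Lemma threshold_rate (T : nat) :
  b * T%:R - b * theta.+1%:R <= total_rate rs f T <= b * T%:R.
Proof.
have /andP[rs0 rs1] := rs01; have /andP[r0 r1] := r01.
(* With zero stage cost, price 1 and average [b], this [h] makes the drift vanish exactly, so both
   martingale bounds apply. *)
pose h t := if (t <= theta)%N then b * t%:R else b * (theta%:R + 1 - r).
have h0 : h 0%N = 0 by rewrite /h leq0n mulr0.
have hge t : 0 <= h t.
  rewrite /h; case: ifP => _; rewrite mulr_ge0 ?(ltW b0) //.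
  by have := ler0n R theta; lra.
have hle t : h t <= b * theta.+1%:R.
  rewrite /h; case: ifP => tt; rewrite ler_pM2l // ?ler_nat ?leqW //.
  by rewrite -natr1; lra.
have drift k (s : k.+1.-tuple nat) (u : k.-tuple bool) t : t = last 0%N s ->
    f s u * (0 + 1 - b + (1 - rs) * h t.+1 - h t)
      + (1 - f s u) * (0 - b + h t.+1 - h t) = 0.
  move=> tE; rewrite /f /threshold_policy -tE /h.
  have [tt|tt|->] := ltngtP t theta.
  - by rewrite -natr1; ring.
  - by move: budget; lra.
  - by move: budget; nra.
have lower : b * T%:R - b * theta.+1%:R <=
    total_cost rs f (fun=> 0) T + 1 * total_rate rs f T.
  apply: (@submartingale_bound _ _ _ _ h) => // [|k s u t tE].
    exact: threshold_admissible.
  by rewrite (drift _ _ _ _ tE).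
have upper : total_cost rs f (fun=> 0) T + 1 * total_rate rs f T <= b * T%:R.
  apply: (@supermartingale_bound _ _ _ _ h) => // [|k s u t tE].
    exact: threshold_admissible.
  by rewrite (drift _ _ _ _ tE).
move: lower upper.
have -> : total_cost rs f (fun=> 0) T = 0.
  rewrite -[RHS](cond_expect_cst rs f 0 T [tuple 0%N] [tuple]).
  by congr expect; apply/funext => s; apply/funext => u; rewrite big1.
by rewrite add0r mul1r => -> ->.
Qed.

Lemma threshold_J_r : J_r rs f = b%:E.
Proof.
apply/eqP; rewrite eq_le; apply/andP; split.
  apply: limn_esup_le_near => e e0.
  near=> T.
  have T0 : (0 < T)%N by near: T; exists 1%N.
  have /andP[_] := threshold_rate T; rewrite -ler_pdivrMr ?ltr0n // mulrC => H.
  by apply: le_trans H _; rewrite lerDl ltW.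
apply: le_limn_esup_near => e e0.
near=> T.
have [T0 Te] : (0 < T)%N /\ T%:R^-1 * (b * theta.+1%:R) <= e.
  by near: T; exact: near_mulVn_le.
have /andP[H _] := threshold_rate T.
have T0' : 0 < T%:R :> R by rewrite ltr0n.
have Ti0 : 0 <= T%:R^-1 :> R by rewrite invr_ge0 ler0n.
have := ler_wpM2l Ti0 H.
by rewrite mulrBr [X in X - _]mulrC mulfK ?lt0r_neq0 //; rewrite /total_rate; lra.
Unshelve. all: by end_near.
Qed.

Definition avg_cost (g : policy R) : \bar R :=
  limn_esup (fun T => (T%:R^-1 * total_cost rs g c T)%:E).

(** Weak duality: with price [l >= 0] and rate at most [b], the truncated cost bounds every feasible
    policy from below. The formulas for [l] and [g] are exported to bound [l] uniformly in [N]. *)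
Lemma truncated_bounds (N : nat) :
  exists g l : R, [/\ 0 <= l, l = rs * \sum_(i < theta.+1) (g - c (minn i N)),
    c (minn theta N) <= g, rs = 1 -> g = c (minn theta.+1 N) &
    (forall p, feasible rs b p -> ((g - l * b)%:E <= avg_cost p)%E) /\
    total_cost rs f c N + l * total_rate rs f N <= g * N%:R].
Proof.
have cN_ndecr : {homo (fun t => c (minn t N)) : s t / (s <= t)%N >-> s <= t}.
  by move=> s t st; apply: c_ndecr; rewrite leq_min geq_minr (leq_trans (geq_minl _ _)).
have cN_cst t : (N <= t)%N -> c (minn t N) = c (minn N N).
  by move=> Nt; rewrite minnn (minn_idPr Nt).
have [g [l [h [H [[lE cg g1 h0 hH] [d0 d1 e0 e1]]]]]] :=
  threshold_potential rs01 cN_ndecr cN_cst theta.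
have l0 : 0 <= l.
  rewrite lE mulr_ge0 ?sumr_ge0 //; first by case/andP: rs01'.
  move=> i _; rewrite subr_ge0; apply: le_trans cg; apply: cN_ndecr.
  by rewrite -ltnS.
exists g, l; split=> //; split=> [p [padm pb]|].
  apply: le_limn_esup_near => e e00.
  have e2 : 0 < e / 2 by rewrite divr_gt0.
  (* This slack in the rate costs at most [e / 2] after multiplication by [l]; adding 1 covers
     [l = 0]. *)
  have el : 0 < e / 2 / (l + 1) by rewrite divr_gt0 // ltr_wpDl.
  near=> T.
  have [T0 Te] : (0 < T)%N /\ T%:R^-1 * H <= e / 2.
    by near: T; exact: near_mulVn_le.
  have rate : T%:R^-1 * total_rate rs p T <= b + e / 2 / (l + 1).
    by near: T; exact: near_limn_esup_le.
  have T0' : 0 < T%:R :> R by rewrite ltr0n.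
  have Ti0 : 0 <= T%:R^-1 :> R by rewrite invr_ge0 ler0n.
  have lower : g * T%:R - H <= total_cost rs p c T + l * total_rate rs p T.
    apply: (@le_trans _ _
      (total_cost rs p (fun t => c (minn t N)) T + l * total_rate rs p T)).
      apply: (@submartingale_bound _ _ _ _ h) => // [t|k s u t _].
        by case/andP: (hH t).
      have /andP[p0 p1] := padm k s u.
      by rewrite addr_ge0 // mulr_ge0 // subr_ge0.
    by rewrite lerD2r total_cost_le // => t _; apply: c_ndecr; exact: geq_minl.
  have := ler_wpM2l Ti0 lower.
  rewrite mulrBr [X in X - _]mulrC mulfK ?lt0r_neq0 // mulrDr mulrCA.
  have := ler_wpM2l l0 rate.
  have : l * (e / 2 / (l + 1)) <= e / 2.
    by rewrite mulrA ler_pdivrMr ?ltr_wpDl // mulrC ler_pM2l // lerDl.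
  lra.
apply: (@le_trans _ _
  (total_cost rs f (fun t => c (minn t N)) N + l * total_rate rs f N)).
  rewrite lerD2r; apply: total_cost_le => // [|t tN].
    exact: threshold_admissible.
  by rewrite (minn_idPl tN).
apply: (@supermartingale_bound _ _ _ _ h) => //; first exact: threshold_admissible.
  by move=> t; case/andP: (hH t).
move=> k s u t tE; rewrite /f /threshold_policy -tE.
have [tt|tt|tt] := ltngtP t theta.
- by rewrite e0 ?(ltnW tt) // mul0r mulr0 addr0.
- by rewrite e1 ?(ltnW tt) // subrr mul0r mulr0 addr0.
(* At [theta] both defects vanish, so every randomization gives equality. *)
- by rewrite e0 ?e1 ?tt // !mulr0 addr0.
Unshelve. all: by end_near.
Qed.

(** Truncating at [N = T] for each horizon [T] gives a total cost of at most [T] times the value of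
    [p] plus [l * b * theta.+1]. It remains to bound [l] independently of [T]. *)
Lemma threshold_optimal (p : policy R) :
  feasible rs b p -> (avg_cost f <= avg_cost p)%E.
Proof.
move=> pfeas.
have /andP[rs0 rs1] := rs01; have /andP[r0 r1] := r01.
case pE : (avg_cost p) => [x||]; last 2 first.
- by rewrite leey.
(* Any truncation gives a finite lower bound, which excludes the value [-oo]. *)
- have [g [l [_ _ _ _ [/(_ p pfeas) H _]]]] := truncated_bounds 0.
  by move: H; rewrite pE.
(* [B] bounds [g - c 0] for all truncations. For [rs < 1], combine [g - l * b <= x] with
   [l <= rs * theta.+1 * (g - c 0)]; by [budget], [1 - b * rs * theta.+1 = b * (1 - r * rs)], which
   is positive. For [rs = 1] this factor may vanish, but then [g] is explicit. *)
pose B := if rs == 1 then c theta.+1 - c 0%N else (x - c 0%N) / (b * (1 - r * rs)).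
apply: limn_esup_le_near => e e0.
near=> T.
have [T0 Te] : (0 < T)%N /\
    T%:R^-1 * (rs * theta.+1%:R * B * (b * theta.+1%:R)) <= e.
  by near: T; exact: near_mulVn_le.
have T0' : 0 < T%:R :> R by rewrite ltr0n.
have Ti0 : 0 <= T%:R^-1 :> R by rewrite invr_ge0 ler0n.
have [g [l [l0 lE cg g1 [/(_ p pfeas) lower upper]]]] := truncated_bounds T.
rewrite pE lee_fin in lower.
have lle : l <= rs * (theta.+1%:R * (g - c 0%N)).
  rewrite lE ler_pM2l //.
  have -> : theta.+1%:R * (g - c 0%N) = \sum_(i < theta.+1) (g - c 0%N).
    by rewrite sumr_const card_ord mulr_natl.
  by apply: ler_sum => i _; rewrite lerD2l lerN2 c_ndecr.
have gB : g - c 0%N <= B.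
  rewrite /B; case: eqP => [rsE|/eqP rsN1].
    by rewrite g1 // lerD2r c_ndecr // geq_minl.
  have rs_lt1 : rs < 1 by rewrite lt_neqAle rsN1.
  have k0 : 0 < 1 - r * rs.
    by have := ler_wpM2r (ltW rs0) r1; lra.
  rewrite ler_pdivlMr ?mulr_gt0 //.
  have := ler_wpM2r (ltW b0) lle; rewrite -natr1.
  have : (g - c 0%N) * (b * (1 + rs * (theta%:R + 1 - r))) = g - c 0%N.
    by rewrite budget mulr1.
  by move: lower; lra.
have lB : l <= rs * theta.+1%:R * B.
  by apply: le_trans lle _; rewrite mulrA ler_pM2l // mulr_gt0.
have /andP[rate _] := threshold_rate T.
have cost : total_cost rs f c T <=
    (g - l * b) * T%:R + rs * theta.+1%:R * B * (b * theta.+1%:R).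
  have := ler_wpM2l l0 rate.
  have bt0 : 0 <= b * theta.+1%:R by rewrite mulr_ge0 // ltW.
  have := ler_wpM2r bt0 lB.
  lra.
have := ler_wpM2l Ti0 cost.
rewrite mulrDr [X in X + _]mulrC mulfK ?lt0r_neq0 //; lra.
Unshelve. all: by end_near.
Qed.
End Threshold.

(** The equation amounts to [theta + 1 - r = x] with [x = (1 - b) / (b * rs)], so [theta] is the
    integer part of [x] and [r] is one minus its fractional part. *)
Lemma budget_threshold (R : realType) (rs b : R) : 0 < rs -> 0 < b <= 1 ->
  exists (theta : nat) (r : R),
    0 <= r <= 1 /\ b * (1 + rs * (theta%:R + 1 - r)) = 1.
Proof.
move=> rs0 /andP[b0 b1]; pose x := (1 - b) / (b * rs).
have x0 : 0 <= x by rewrite divr_ge0 ?subr_ge0 // mulr_ge0 // ltW.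
have /andP[tx xt] := truncn_itv x0.
exists (Num.trunc x), ((Num.trunc x)%:R + 1 - x); split.
  by move: tx xt; rewrite -natr1 => tx xt; apply/andP; split; lra.
by rewrite subKr /x; field; rewrite !lt0r_neq0.
Qed.

Theorem theorem2 (R : realType) (n m : nat)
    (A : 'M[R]_n.+1) (C : 'M[R]_(m.+1, n.+1))
    (Sigma_w Pi sqrt_w Pbar : 'M[R]_n.+1) (Sigma_v : 'M[R]_m.+1)
    (rs b : R)
    (hw : psd Sigma_w) (hPi : psd Pi) (hv : posdef Sigma_v)
    (hdet : detectable A C)
    (hsqrt : is_psd_sqrt sqrt_w Sigma_w) (hstab : stabilizable A sqrt_w)
    (hPbar : steady_state_cov A C Sigma_w Sigma_v Pi Pbar)
    (hrs : 0 < rs <= 1) (hb : 0 < b <= 1) :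
  exists (theta : nat) (r : R),
    [/\ 0 <= r <= 1,
        constrained_optimal A Sigma_w Pbar rs b (threshold_policy theta r) &
        J_r rs (threshold_policy theta r) = b%:E].
Proof.
have [rs0 _] := andP hrs; have [b0 _] := andP hb.
have [theta [r [r01 budget]]] := budget_threshold rs0 hb.
have cmon := remote_cov_trace_nondecreasing hw hv hPi hPbar.
have JrE := threshold_J_r hrs b0 r01 budget.
exists theta, r; split=> //.
have feas : feasible rs b (threshold_policy theta r).
  by split; [exact: threshold_admissible | rewrite JrE].
split=> //; apply/eqP; rewrite eq_le; apply/andP; split.
  apply: le_ereal_inf_tmp => _ [p pfeas <-].
  exact: (threshold_optimal hrs b0 r01 cmon budget pfeas).
by apply: ereal_inf_lbound; exists (threshold_policy theta r).
Qed.
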